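(* Let $\Delta\subset\mathbb{R}^n$ be an absolutely symmetric set and let $\Gamma=\{X\in\mathbb{M}_{m,n}:\sigma(X)\in\Delta\}$ be the associated orthogonally invariant matrix set. Then for any $X\in\Gamma$, $$T_\Gamma(X)=\{H\in\mathbb{M}_{m,n}:\ \sigma'(X;H)\in T_\Delta(\sigma(X))\}.$$
   Context: Throughout, $m,n$ are natural numbers with $n\le m$; $\mathbb{M}_{m,n}$ is the space of real $m\times n$ matrices with the Frobenius norm; $\sigma(X)=(\sigma_1(X),\dots,\sigma_n(X))$ is the vector of singular values of $X$ in nonincreasing order, and $\sigma'(X;H)=\lim_{t\downarrow0}(\sigma(X+tH)-\sigma(X))/t$ (it always exists). A set $\Delta\subset\mathbb{R}^n$ is absolutely symmetric if it is invariant under all $n\times n$ signed permutation matrices (entries in $\{0,\pm1\}$, exactly one nonzero entry in each row and column). A set $\Gamma\subset\mathbb{M}_{m,n}$ is orthogonally invariant if $X\in\Gamma$ implies $U^TXV\in\Gamma$ for all orthogonal $U$ ($m\times m$) and $V$ ($n\times n$); every such $\Gamma$ has the form $\{X:\sigma(X)\in\Delta\}$ with $\Delta=\{x\in\mathbb{R}^n:\mathrm{diag}(x)\in\Gamma\}$ absolutely symmetric, where $\mathrm{diag}(x)$ is the $m\times n$ diagonal matrix with diagonal $x$. For a subset $C$ of a Euclidean space and $\bar x\in C$, the tangent cone is $T_C(\bar x)=\{w:\exists\,t_k\downarrow0,\ w_k\to w,\ \bar x+t_kw_k\in C\}$. *)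

(* Defs.v *)
From HB Require Import structures.
From mathcomp Require Import all_boot all_order all_algebra.
From mathcomp Require Import polyrcf.
From mathcomp Require Import all_classical all_reals all_analysis.

Set Implicit Arguments.
Unset Strict Implicit.
Unset Printing Implicit Defensive.

Import Order.TTheory GRing.Theory Num.Theory.
Import numFieldNormedType.Exports.

Local Open Scope classical_set_scope.
Local Open Scope ring_scope.

Definition roots_with_mult (R : rcfType) (p : {poly R}) : seq R :=
  flatten [seq nseq (mup x p) x | x <- rootsR p].

(* The singular values of an m x n matrix (n <= m) are the square roots of the
   eigenvalues of X^T *m X.  This matrix is real symmetric positive
   semidefinite, so its characteristic polynomial splits over R with
   nonnegative roots and the list has exactly n entries. *)
Definition singular_values (R : rcfType) (m n : nat) (X : 'M[R]_(m, n)) :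
    seq R :=
  sort >=%R
    [seq Num.sqrt x | x <- roots_with_mult (char_poly (X^T *m X))].

Definition sigma (R : rcfType) (m n : nat) (X : 'M[R]_(m, n)) : 'cV[R]_n :=
  \col_(i < n) (singular_values X)`_i.

(* This one-sided limit exists for all X and H, so the default value of [lim]
   is never used. *)
Definition dsigma (R : realType) (m n : nat) (X H : 'M[R]_(m, n)) :
    'cV[R]_n :=
  lim ((fun t : R => t^-1 *: (sigma (X + t *: H) - sigma X)) @ 0^'+).

Definition signed_perm_mx (R : realType) (n : nat) (P : 'M[R]_n) : Prop :=
  [/\ forall i j, P i j \in [:: 0; 1; -1],
      forall i, exists! j, P i j != 0
    & forall j, exists! i, P i j != 0].

Definition absolutely_symmetric (R : realType) (n : nat)
    (Delta : set 'cV[R]_n) : Prop :=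
  forall (P : 'M[R]_n) (x : 'cV[R]_n),
    signed_perm_mx P -> Delta x -> Delta (P *m x).

Definition associated_mx_set (R : realType) (m n : nat)
    (Delta : set 'cV[R]_n) : set 'M[R]_(m, n) :=
  [set X | Delta (sigma X)].
Arguments associated_mx_set {R} m {n} Delta.

(* On matrices the library norm is the max norm; it induces the same
   convergence as the Frobenius norm, and the cone depends on nothing else. *)
Definition tangent_cone (R : realType) (E : normedModType R) (C : set E)
    (x : E) : set E :=
  [set w | exists (t : nat -> R) (v : nat -> E),
    [/\ forall k, 0 < t k, t @ \oo --> 0, v @ \oo --> w
      & forall k, C (x + t k *: v k)]].

(* Main.v *)
Require Import Defs.
From mathcomp Require Import all_boot all_order all_algebra.
From mathcomp Require Import perm polyrcf ring lra.
From mathcomp Require Import all_classical all_reals all_analysis.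
Import Order.TTheory GRing.Theory Num.Theory.
Import numFieldNormedType.Exports.
Local Open Scope classical_set_scope.
Local Open Scope ring_scope.

Set Implicit Arguments.
Unset Strict Implicit.
Unset Printing Implicit Defensive.

(** The singular values of [A *m D *m B], with [A] and [B] orthogonal and [D]
rectangular diagonal, are the sorted absolute values of the diagonal of [D]
([sigma_rdiag_mx_signed_perm]); so an absolutely symmetric [Delta] contains the
diagonal [x] as a vector only if it contains [sigma (A *m rdiag_mx m x *m B)].

Suppose that [sigma X + t_k v_k] lies in [Delta], with [t_k > 0] tending to [0]
and [v_k] tending to [sigma'(X; H)].  Take a singular value decomposition
[X + t_k H = A_k diag(sigma (X + t_k H)) B_k] and replace the diagonal by
[sigma X + t_k v_k].  The new matrix is in [Gamma] by the remark above, and it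
differs from [X + t_k H] by [t_k A_k diag(v_k - q_k) B_k], where [q_k] is the
difference quotient [(sigma (X + t_k H) - sigma X) / t_k].  Both [v_k] and [q_k]
tend to [sigma'(X; H)], so this error is [o(t_k)] and the new matrix has the
form [X + t_k H_k] with [H_k] tending to [H].  Conversely, if [X + t_k H_k] is
in [Gamma] and [H_k] tends to [H], then the difference quotients
[(sigma (X + t_k H_k) - sigma X) / t_k] are the required tangent sequence for
[Delta].

Both directions need the difference quotients to converge to [sigma'(X; H)],
even when the direction varies with [k] ([dsigma_cvg_seq]).  This is obtained
from convexity: by Ky Fan's principle ([partial_trace_le] and
[partial_trace_attained]) the sum of the [k] largest singular values of [X] is
the maximum, over orthogonal [A] and [B], of the linear function of [X] that
sums the first [k] diagonal entries of [A *m X *m B].  A maximum of linear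
functions with a common bound is convex and Lipschitz, hence has one-sided
directional derivatives; each singular value is a difference of two such
sums.

The singular value decomposition itself ([svd]) comes from maximizing
[u X v^T] over pairs of unit vectors: a maximizing pair is a pair of singular
vectors, and orthogonal changes of basis that start with it split off a
[1 x 1] block. *)

(** * Orthogonal matrices and rectangular diagonal matrices *)

Definition orthomx (R : comPzRingType) n (A : 'M[R]_n) : Prop :=
  A *m A^T = 1%:M.

Lemma orthomx_trmx (R : comPzRingType) n (A : 'M[R]_n) :
  orthomx A -> orthomx A^T.
Proof. by rewrite /orthomx trmxK => /mulmx1C. Qed.

Lemma orthomx_mulmx (R : comPzRingType) n (A B : 'M[R]_n) :
  orthomx A -> orthomx B -> orthomx (A *m B).
Proof.
move=> oA oB; rewrite /orthomx trmx_mul mulmxA -(mulmxA A) oB mulmx1.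
exact: oA.
Qed.

Lemma orthomx_row_sqr (R : comPzRingType) n (A : 'M[R]_n) i :
  orthomx A -> \sum_j A i j ^+ 2 = 1.
Proof.
move=> /matrixP/(_ i i); rewrite !mxE eqxx mulr1n => <-.
by apply: eq_bigr => j _; rewrite mxE expr2.
Qed.

Lemma orthomx_col_sqr (R : comPzRingType) n (A : 'M[R]_n) j :
  orthomx A -> \sum_i A i j ^+ 2 = 1.
Proof.
move=> /orthomx_trmx/orthomx_row_sqr => /(_ j) <-.
by apply: eq_bigr => i _; rewrite mxE.
Qed.

Lemma orthomx_entry_le1 (R : realDomainType) n (A : 'M[R]_n) i j :
  orthomx A -> `|A i j| <= 1.
Proof.
move=> /(@orthomx_row_sqr _ _ _ i) => rowA.
rewrite -(@ler_pXn2r _ 2) ?nnegrE// expr1n real_normK ?num_real//.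
by rewrite -rowA (bigD1 j)//= lerDl sumr_ge0// => k _; rewrite sqr_ge0.
Qed.

Definition rdiag_mx (R : pzSemiRingType) m n (x : 'cV[R]_n) : 'M[R]_(m, n) :=
  \matrix_(i, j) (x j 0 *+ (i == j :> nat)).
Arguments rdiag_mx {R} m {n} x.

Lemma rdiag_mxD (R : pzRingType) m n (x y : 'cV[R]_n) :
  rdiag_mx m (x + y) = rdiag_mx m x + rdiag_mx m y.
Proof. by apply/matrixP => i j; rewrite !mxE mulrnDl. Qed.

Lemma rdiag_mxZ (R : pzRingType) m n a (x : 'cV[R]_n) :
  rdiag_mx m (a *: x) = a *: rdiag_mx m x.
Proof. by apply/matrixP => i j; rewrite !mxE mulrnAr. Qed.

Lemma mulmx_rdiag_mxE (R : comPzRingType) m n p q (le_nm : (n <= m)%N)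
    (A : 'M[R]_(p, m)) (x : 'cV[R]_n) (B : 'M[R]_(n, q)) i j :
  (A *m rdiag_mx m x *m B) i j =
  \sum_l A i (widen_ord le_nm l) * x l 0 * B l j.
Proof.
rewrite !mxE; apply: eq_bigr => l _; rewrite !mxE; congr (_ * _).
rewrite (bigD1 (widen_ord le_nm l))//= !mxE eqxx mulr1n big1 ?addr0// => k kl.
by rewrite !mxE -val_eqE/= in kl *; rewrite (negPf kl) mulr0n mulr0.
Qed.

(** * Singular values of a matrix in diagonal form *)

Lemma char_poly_orthomx (R : comNzRingType) n (B D : 'M[R]_n) :
  orthomx B -> char_poly (B^T *m D *m B) = char_poly D.
Proof.
move=> oB; have oB' := mulmx1C oB.
pose C := map_mx polyC B.
have CC : C^T *m C = 1%:M.
  by rewrite map_trmx -map_mxM oB' map_mx1.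
rewrite /char_poly.
have -> : char_poly_mx (B^T *m D *m B) = C^T *m char_poly_mx D *m C.
  rewrite /char_poly_mx !map_mxM -map_trmx -/C mulmxBr mulmxBl.
  by rewrite (scalar_mxC _ C^T) -(mulmxA _%:M) CC mulmx1.
rewrite !det_mulmx mulrAC -det_mulmx CC det1 mul1r //.
Qed.

(** The distinct roots are the entries of [undup s], each with its number of
occurrences in [s] as multiplicity. *)
Lemma roots_with_mult_prod_XsubC (R : rcfType) (s : seq R) :
  perm_eq (roots_with_mult (\prod_(a <- s) ('X - a%:P))) s.
Proof.
set p := \prod_(a <- s) _.
have p0 : p != 0 by rewrite monic_neq0// monic_prod_XsubC.
have rE : perm_eq (rootsR p) (undup s).
  apply: uniq_perm; rewrite ?undup_uniq ?uniq_roots// => x.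
  by rewrite -roots_on_rootsR// inE /= root_prod_XsubC mem_undup.
apply: perm_trans (perm_count_undup s).
rewrite /roots_with_mult.
rewrite (eq_map (fun x => congr1 (nseq^~ x) (mu_prod_XsubC x s))).
exact/perm_flatten/perm_map.
Qed.

Lemma trmx_rdiag_mx_mulmx (R : comPzRingType) m n (le_nm : (n <= m)%N)
    (x : 'cV[R]_n) :
  (rdiag_mx m x)^T *m rdiag_mx m x = diag_mx (\row_i (x i 0 ^+ 2)).
Proof.
apply/matrixP => i j; rewrite !mxE (bigD1 (widen_ord le_nm i))//= !mxE eqxx.
rewrite big1 => [|k ki]; last first.
  by rewrite !mxE -val_eqE/= in ki *; rewrite (negPf ki) mulr0n mul0r.
rewrite addr0 mulr1n -val_eqE /=.
case: eqP => [/val_inj->|]; last by rewrite mulr0.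
by rewrite !mulr1n expr2.
Qed.

(** Here [X^T *m X] is orthogonally similar to the diagonal matrix of the
squares [x i 0 ^+ 2], whose square roots are the [`|x i 0|]. *)
Lemma singular_values_rdiag_mx (R : rcfType) m n (le_nm : (n <= m)%N)
    (A : 'M[R]_m) (x : 'cV[R]_n) (B : 'M[R]_n) :
  orthomx A -> orthomx B ->
  singular_values (A *m rdiag_mx m x *m B) =
  sort >=%R [seq `|x i 0| | i <- enum 'I_n].
Proof.
move=> oA oB; rewrite /singular_values.
have -> : (A *m rdiag_mx m x *m B)^T *m (A *m rdiag_mx m x *m B) =
    B^T *m diag_mx (\row_i (x i 0 ^+ 2)) *m B.
  rewrite -(trmx_rdiag_mx_mulmx le_nm) !trmx_mul !mulmxA.
  by rewrite -[_ *m A^T *m A]mulmxA (mulmx1C oA) mulmx1.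
rewrite char_poly_orthomx// char_poly_trig ?diag_mx_is_trig//.
have -> : \prod_(i < n) ('X - (diag_mx (\row_i (x i 0 ^+ 2)) i i)%:P) =
    \prod_(a <- [seq x i 0 ^+ 2 | i <- enum 'I_n]) ('X - a%:P).
  rewrite big_map big_enum /=; apply: eq_bigr => i _.
  by rewrite !mxE eqxx.
apply/perm_sortP; [exact: ge_total|exact: ge_trans|exact: ge_anti|].
apply: perm_trans (perm_map _ (roots_with_mult_prod_XsubC _)) _.
rewrite -map_comp; apply: etrans (perm_refl _); congr perm_eq.
by apply: eq_map => i /=; rewrite sqrtr_sqr.
Qed.

Lemma sigma_rdiag_mx_sorted (R : rcfType) m n (le_nm : (n <= m)%N)
    (A : 'M[R]_m) (x : 'cV[R]_n) (B : 'M[R]_n) :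
  orthomx A -> orthomx B -> (forall i, 0 <= x i 0) ->
  (forall i j : 'I_n, (i <= j)%N -> x j 0 <= x i 0) ->
  sigma (A *m rdiag_mx m x *m B) = x.
Proof.
move=> oA oB x0 xS; apply/colP => i; rewrite mxE singular_values_rdiag_mx//.
rewrite sorted_sort; first last.
- rewrite sorted_map (sub_sorted (e := relpre val leq))//.
    by move=> a b /= ab; rewrite !ger0_norm// xS.
  by rewrite -sorted_map val_enum_ord iota_sorted.
- exact: ge_trans.
by rewrite (nth_map i) ?size_enum_ord// nth_ord_enum ger0_norm.
Qed.

(** Sorting the absolute values of a vector amounts to multiplying it by a
signed permutation matrix: this is where absolute symmetry enters. *)
Lemma sigma_rdiag_mx_signed_perm (R : realType) m n (le_nm : (n <= m)%N)
    (A : 'M[R]_m) (x : 'cV[R]_n) (B : 'M[R]_n) :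
  orthomx A -> orthomx B ->
  exists2 P, signed_perm_mx P & sigma (A *m rdiag_mx m x *m B) = P *m x.
Proof.
move=> oA oB; pose s := [tuple `|x i 0| | i < n].
have /tuple_permP[p sE] : perm_eq (sort >=%R s) s by rewrite perm_sort.
(* The sign of 0 is taken to be 1, because the entries of P must not vanish. *)
pose sg i : R := if x i 0 < 0 then -1 else 1.
have sg0 i : sg i != 0 by rewrite /sg; case: ifP; rewrite ?oppr_eq0 oner_eq0.
pose P : 'M[R]_n := \matrix_(i, j) (sg j *+ (j == p i)).
have P0 i j : (P i j != 0) = (j == p i).
  by rewrite mxE; case: (j == p i); rewrite ?mulr1n ?mulr0n ?eqxx ?sg0.
exists P.
  split=> [i j|i|j].
  - rewrite mxE /sg; case: (j == p i); rewrite ?mulr0n ?mulr1n ?inE ?eqxx//.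
    by case: ifP; rewrite eqxx ?orbT.
  - by exists (p i); split=> [|j]; rewrite P0 // => /eqP.
  - exists ((p^-1)%g j); split=> [|i]; rewrite P0 ?permKV//.
    by move=> /eqP->; rewrite permK.
apply/colP => i; rewrite mxE singular_values_rdiag_mx//.
have -> : [seq `|x i 0| | i <- enum 'I_n] = s by [].
rewrite sE (nth_map i) ?size_enum_ord// nth_ord_enum tnth_mktuple !mxE.
rewrite (bigD1 (p i))//= !mxE eqxx mulr1n big1 ?addr0 => [|j jp].
  rewrite /sg; case: ltrP => [/ltr0_norm->|/ger0_norm->].
    by rewrite mulN1r.
  by rewrite mul1r.
by rewrite mxE (negPf jp) mulr0n mul0r.
Qed.

(** * Max norm and entrywise convergence of matrices *)

Lemma mx_norm_leP (R : realFieldType) m n (X : 'M[R]_(m, n)) c : 0 <= c ->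
  reflect (forall i j, `|X i j| <= c) (`|X| <= c).
Proof.
move=> c0; rewrite [`|X|]/Num.norm/= mx_normrE.
apply: (iffP (bigmax_leP _ _ _ _)) => [[_ Xc] i j|Xc]; first exact: (Xc (i, j)).
by split=> // -[i j] _; exact: Xc.
Qed.

Lemma mx_entry_le_norm (R : realFieldType) m n (X : 'M[R]_(m, n)) i j :
  `|X i j| <= `|X|.
Proof. by have /(mx_norm_leP X (normr_ge0 X)) := lexx `|X|; exact. Qed.

Lemma cvg_mx (R : realFieldType) (T : Type) (F : set_system T) {FF : Filter F}
    m n (f : T -> 'M[R]_(m, n)) (L : 'M[R]_(m, n)) :
  (forall i j, f x i j @[x --> F] --> L i j) -> f x @[x --> F] --> L.
Proof.
move=> fL; apply/cvgrPdist_le => e e0.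
have : \forall x \near F,
    forall ij : 'I_m * 'I_n, `|L ij.1 ij.2 - f x ij.1 ij.2| <= e.
  apply: filter_forall => -[i j]; move/cvgrPdist_le: (fL i j); exact.
apply: filterS => x Lf; apply/mx_norm_leP; first exact: ltW.
by move=> i j; rewrite !mxE; exact: (Lf (i, j)).
Qed.

Lemma cvg_mx_entry (R : realFieldType) (T : Type) (F : set_system T)
    {FF : Filter F} m n (f : T -> 'M[R]_(m, n)) (L : 'M[R]_(m, n)) i j :
  f x @[x --> F] --> L -> f x i j @[x --> F] --> L i j.
Proof.
move=> fL.
exact: (@continuous_cvg _ _ _ F FF f (fun M : 'M[R]_(m, n) => M i j) L
  (@coord_continuous _ _ _ _ _ _)).
Qed.

(** * Dot products and the unit sphere *)

Definition dotv (R : pzSemiRingType) n (u v : 'rV[R]_n) : R := (u *m v^T) 0 0.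

Lemma dotvE (R : pzSemiRingType) n (u v : 'rV[R]_n) :
  dotv u v = \sum_i u 0 i * v 0 i.
Proof. by rewrite /dotv mxE; apply: eq_bigr => i _; rewrite mxE. Qed.

Lemma mulmx_dotv (R : pzSemiRingType) n (u v : 'rV[R]_n) :
  u *m v^T = (dotv u v)%:M.
Proof. exact: mx11_scalar. Qed.

Lemma dotvC (R : comPzRingType) n (u v : 'rV[R]_n) : dotv u v = dotv v u.
Proof. by rewrite !dotvE; apply: eq_bigr => i _; rewrite mulrC. Qed.

Lemma dotvBl (R : comPzRingType) n (u v w : 'rV[R]_n) :
  dotv (u - v) w = dotv u w - dotv v w.
Proof. by rewrite /dotv mulmxBl !mxE. Qed.

Lemma dotvBr (R : comPzRingType) n (u v w : 'rV[R]_n) :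
  dotv w (u - v) = dotv w u - dotv w v.
Proof. by rewrite dotvC dotvBl !(dotvC w). Qed.

Lemma dotvZl (R : comPzRingType) n a (u w : 'rV[R]_n) :
  dotv (a *: u) w = a * dotv u w.
Proof. by rewrite /dotv -scalemxAl mxE. Qed.

Lemma dotvZr (R : comPzRingType) n a (u w : 'rV[R]_n) :
  dotv w (a *: u) = a * dotv w u.
Proof. by rewrite dotvC dotvZl dotvC. Qed.

Lemma dotv_ge0 (R : realDomainType) n (u : 'rV[R]_n) : 0 <= dotv u u.
Proof. by rewrite dotvE sumr_ge0// => i _; rewrite -expr2 sqr_ge0. Qed.

Lemma dotv_eq0 (R : realDomainType) n (u : 'rV[R]_n) :
  (dotv u u == 0) = (u == 0).
Proof.
apply/eqP/eqP => [|->]; last by rewrite /dotv mul0mx mxE.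
rewrite dotvE => /psumr_eq0P u0; apply/rowP => i; rewrite mxE.
apply/eqP; rewrite -sqrf_eq0 expr2 u0//.
by move=> j _; rewrite -expr2 sqr_ge0.
Qed.

Lemma dotv_e0 (R : comPzRingType) n (u : 'rV[R]_n.+1) :
  dotv u (delta_mx 0 0) = u 0 0.
Proof.
rewrite dotvE (bigD1 ord0)//= big1 => [|i i0].
  by rewrite mxE !eqxx mulr1 addr0.
by rewrite mxE (negPf i0) andbF mulr0.
Qed.

(** A Householder reflection: for [w = u - e_0] the symmetric orthogonal matrix
[1 - 2 w^T w / |w|^2] exchanges [e_0] and [u]. *)
Lemma orthomx_row0 (R : realFieldType) n (u : 'rV[R]_n.+1) :
  dotv u u = 1 -> exists2 P : 'M[R]_n.+1, orthomx P & row 0 P = u.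
Proof.
move=> uu; pose e : 'rV[R]_n.+1 := delta_mx 0 0.
have ee : dotv e e = 1 by rewrite dotv_e0 mxE !eqxx.
have [w wE] : exists w, w = u - e by exists (u - e).
have [w0|w0] := eqVneq w 0.
  exists 1%:M; first by rewrite /orthomx trmx1 mulmx1.
  by rewrite row1; apply/esym/eqP; rewrite -subr_eq0 -wE w0.
have ww : dotv w w = 2 - 2 * u 0 0.
  rewrite wE !(dotvBl, dotvBr) uu ee (dotvC e u) dotv_e0; ring.
have nz : 2 - 2 * u 0 0 != 0 by rewrite -ww dotv_eq0.
pose c := 2 / (2 - 2 * u 0 0); pose P := 1%:M - c *: (w^T *m w).
have PT : P^T = P.
  by rewrite [LHS]linearB [X in _ - X]linearZ /= trmx1 trmx_mul trmxK.
exists P; last rewrite /P.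
  rewrite /orthomx PT /P.
  rewrite mulmxBl !mulmxBr !mul1mx mulmx1 -scalemxAl -scalemxAr.
  rewrite -mulmxA (mulmxA w) mulmx_dotv ww mul_scalar_mx -scalemxAr !scalerA.
  rewrite (_ : c * (c * _) = c + c) ?scalerDl; last by rewrite /c; field.
  by rewrite opprB addrK subrK.
rewrite rowE mulmxBr mulmx1 -scalemxAr mulmxA mulmx_dotv mul_scalar_mx scalerA.
rewrite wE dotvBr ee dotvC dotv_e0 (_ : c * _ = -1); last by rewrite /c; field.
by rewrite scaleN1r opprK addrC subrK.
Qed.

Lemma sphere_compact (R : realType) n :
  compact [set u : 'rV[R]_n | dotv u u = 1].
Proof.
apply: bounded_closed_compact.
  exists 1; split=> // M M1 u /= uu.
  apply/mx_norm_leP => [|i j]; first by rewrite ltW// (lt_trans _ M1).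
  apply: le_trans (ltW M1); rewrite (ord1 i).
  rewrite -(@ler_pXn2r _ 2) ?nnegrE// expr1n real_normK ?num_real//.
  rewrite -uu dotvE (bigD1 j)//= -expr2 lerDl sumr_ge0// => k _.
  by rewrite -expr2 sqr_ge0.
rewrite (_ : [set _ | _] = (fun u => dotv u u) @^-1` [set 1])//.
apply: (iffLR (continuous_closedP _)); last exact: closed_eq.
have -> : (fun u : 'rV[R]_n => dotv u u) =
    \sum_i (fun u : 'rV[R]_n => u 0 i * u 0 i).
  by apply/funext => v; rewrite dotvE fct_sumE.
elim/big_ind : _ => [|f g cf cg|i _].
- exact: cst_continuous.
- by move=> u; apply: continuousD; [exact: cf|exact: cg].
- by move=> u; apply: continuousM; apply: coord_continuous.
Qed.

(** By the equality case of the Cauchy-Schwarz inequality: comparing [u] with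
[y / |y|] gives [|y| <= dotv u y], so that [y - dotv u y *: u] has nonpositive
square norm. *)
Lemma max_dotv_sphere (R : rcfType) n (u y : 'rV[R]_n) :
  dotv u u = 1 -> (forall u', dotv u' u' = 1 -> dotv u' y <= dotv u y) ->
  y = dotv u y *: u.
Proof.
move=> uu umax; have [->|y0] := eqVneq y 0.
  by rewrite {1}/dotv trmx0 mulmx0 mxE scale0r.
have yy : 0 < dotv y y by rewrite lt_def dotv_eq0 y0 dotv_ge0.
pose r := Num.sqrt (dotv y y).
have r0 : r != 0 by rewrite gt_eqF// sqrtr_gt0.
have r2 : r ^+ 2 = dotv y y by rewrite sqr_sqrtr// ltW.
have r_le : r <= dotv u y.
  have := umax (r^-1 *: y); rewrite !(dotvZl, dotvZr) -r2.
  rewrite (_ : r^-1 * (r^-1 * _) = 1); last by field.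
  by rewrite (_ : r^-1 * r ^+ 2 = r); [exact|field].
apply/eqP; rewrite -subr_eq0 -dotv_eq0 eq_le dotv_ge0 andbT.
rewrite !(dotvBl, dotvBr, dotvZl, dotvZr) uu (dotvC y u) -r2.
have : r ^+ 2 <= dotv u y ^+ 2.
  by rewrite ler_pXn2r ?nnegrE ?(le_trans _ r_le) ?sqrtr_ge0.
by lra.
Qed.

(** * Singular value decomposition *)

(** A pair of unit vectors maximizing [(u, v) |-> u X v^T] exists by
compactness.  For fixed [v] this form is linear in [u], and vice versa, so
[max_dotv_sphere] applies in each variable. *)
Lemma top_singular_triple (R : realType) m n (X : 'M[R]_(m.+1, n.+1)) :
  exists (u : 'rV[R]_m.+1) (v : 'rV[R]_n.+1) (s : R),
    [/\ dotv u u = 1, dotv v v = 1, u *m X = s *: v, v *m X^T = s *: u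
      & forall u' v',
          dotv u' u' = 1 -> dotv v' v' = 1 -> dotv (u' *m X) v' <= s].
Proof.
pose f (p : 'rV[R]_m.+1 * 'rV[R]_n.+1) := dotv (p.1 *m X) p.2.
pose S k := [set u : 'rV[R]_k.+1 | dotv u u = 1].
have S0 k : S k (delta_mx 0 0) by rewrite /S /= dotv_e0 mxE !eqxx.
have cf : continuous f.
  have -> : f = \sum_j \sum_i (fun p : 'rV[R]_m.+1 * 'rV[R]_n.+1 =>
      p.1 0 i * X i j * p.2 0 j).
    apply/funext => p; rewrite /f dotvE fct_sumE; apply: eq_bigr => j _.
    by rewrite fct_sumE mxE mulr_suml.
  elim/big_ind : _ => [|g h cg ch|j _]; [exact: cst_continuous| |];
    first by move=> p; apply: continuousD; [exact: cg|exact: ch].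
  elim/big_ind : _ => [|g h cg ch|i _]; [exact: cst_continuous| |];
    first by move=> p; apply: continuousD; [exact: cg|exact: ch].
  have c1 : continuous (fun p : 'rV[R]_m.+1 * 'rV[R]_n.+1 => p.1 0 i).
    move=> p.
    apply: (@continuous_comp _ _ _ fst (fun u : 'rV[R]_m.+1 => u 0 i)).
      exact: cvg_fst.
    exact: coord_continuous.
  have c2 : continuous (fun p : 'rV[R]_m.+1 * 'rV[R]_n.+1 => p.2 0 j).
    move=> p.
    apply: (@continuous_comp _ _ _ snd (fun u : 'rV[R]_n.+1 => u 0 j)).
      exact: cvg_snd.
    exact: coord_continuous.
  move=> p; apply: cvgM; last exact: c2.
  by apply: cvgM; [exact: c1|exact: cvg_cst].
have [[u v]] := @compact_EVT_max _ R f (S m `*` S n)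
  (ex_intro _ (delta_mx 0 0, delta_mx 0 0) (conj (S0 m) (S0 n)))
  (compact_setX (@sphere_compact R _) (@sphere_compact R _))
  (continuous_subspaceT cf).
rewrite inE /S /= => -[/= uu vv] fmax.
have {}fmax u' v' : dotv u' u' = 1 -> dotv v' v' = 1 ->
    dotv (u' *m X) v' <= dotv (u *m X) v.
  by move=> uu' vv'; apply: (fmax (u', v')); rewrite inE.
have fT u' v' : dotv (u' *m X) v' = dotv u' (v' *m X^T).
  by rewrite /dotv trmx_mul trmxK mulmxA.
exists u, v, (dotv (u *m X) v); split=> //.
- rewrite dotvC; apply: max_dotv_sphere => // v' vv'.
  by rewrite !(dotvC _ (u *m X)) fmax.
- by rewrite fT; apply: max_dotv_sphere => // u' uu'; rewrite -!fT fmax.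
Qed.

Lemma dotv_row (R : comPzRingType) n (A : 'M[R]_n) i :
  orthomx A -> dotv (row i A) (row i A) = 1.
Proof.
move=> /(@orthomx_row_sqr _ _ _ i) <-; rewrite dotvE.
by apply: eq_bigr => j _; rewrite !mxE expr2.
Qed.

Lemma orthomx_block (R : comNzRingType) n (A : 'M[R]_n) :
  orthomx A -> orthomx (block_mx 1%:M 0 0 A : 'M[R]_(1 + n)).
Proof.
rewrite /orthomx => oA; rewrite tr_block_mx mulmx_block !trmx0 trmx1 oA.
by rewrite !mul0mx !mulmx0 mulmx1 !addr0 add0r -scalar_mx_block.
Qed.

Lemma rdiag_mx_col_mx (R : pzRingType) m n (s : R) (x : 'cV[R]_n) :
  rdiag_mx (1 + m) (col_mx s%:M x) = block_mx s%:M 0 0 (rdiag_mx m x).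
Proof.
apply/matrixP => i j; rewrite [LHS]mxE.
have [i0 ->|i' ->] := split_ordP i; have [j0 ->|j' ->] := split_ordP j.
- by rewrite block_mxEul col_mxEu !ord1 !mxE.
- by rewrite block_mxEur !ord1 !mxE.
- by rewrite block_mxEdl !ord1 !mxE.
- by rewrite block_mxEdr col_mxEd !mxE eqn_add2l.
Qed.

Lemma rdiag_mx_of_svd (R : comPzRingType) m n
    (A : 'M[R]_m) (x : 'cV[R]_n) (B : 'M[R]_n) :
  orthomx A -> orthomx B ->
  A^T *m (A *m rdiag_mx m x *m B) *m B^T = rdiag_mx m x.
Proof.
move=> oA oB.
by rewrite !mulmxA (mulmx1C oA) mul1mx -mulmxA oB mulmx1.
Qed.

(** Induction on the size.  In orthonormal bases that begin with a top singular
pair, the first row and the first column of [X] vanish off the corner [s].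
Since [s] bounds [u X v^T] on all unit vectors, it also bounds the remaining
diagonal entries, which keeps the diagonal sorted. *)
Theorem svd (R : realType) m n (le_nm : (n <= m)%N) (X : 'M[R]_(m, n)) :
  exists (A : 'M[R]_m) (B : 'M[R]_n) (d : 'cV[R]_n),
    [/\ orthomx A, orthomx B, forall i, 0 <= d i 0,
      forall i j : 'I_n, (i <= j)%N -> d j 0 <= d i 0 &
      X = A *m rdiag_mx m d *m B].
Proof.
have o1 k : orthomx (1%:M : 'M[R]_k) by rewrite /orthomx trmx1 mulmx1.
elim: n m le_nm X => [|n IHn] [|m]// le_nm X.
- by exists 1%:M, 1%:M, 0; split=> //; try case=> //; apply/matrixP => i [].
- by exists 1%:M, 1%:M, 0; split=> //; try case=> //; apply/matrixP => i [].
have [u [v [s [uu vv uX vX smax]]]] := top_singular_triple X.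
have s0 : 0 <= s.
  have := smax (-1 *: u) v; rewrite -scalemxAl uX !(dotvZl, dotvZr) uu vv.
  by rewrite mulrA mulrNN !mulr1 => /(_ erefl erefl); lra.
have [P oP rP] := orthomx_row0 uu.
have [Q oQ rQ] := orthomx_row0 vv.
(* X in orthonormal bases that begin with u and v. *)
pose Y : 'M[R]_(1 + m, 1 + n) := P *m X *m Q^T.
have Y0 j : Y 0 j = s *+ (j == 0).
  have -> : Y 0 j = (row 0 Y) 0 j by rewrite [RHS]mxE.
  rewrite /Y !row_mul rP uX -scalemxAl -rQ -row_mul oQ row1 !mxE eqxx/=.
  by rewrite mulr_natr.
have Y0' i : Y i 0 = s *+ (i == 0).
  have -> : Y i 0 = (row 0 Y^T) 0 i by rewrite [RHS]mxE [RHS]mxE.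
  rewrite /Y !trmx_mul trmxK mulmxA !row_mul rQ vX -scalemxAl -rP -row_mul oP.
  by rewrite row1 !mxE eqxx/= mulr_natr.
have YE : Y = block_mx s%:M 0 0 (drsubmx Y).
  rewrite -[LHS]submxK; congr block_mx; apply/matrixP => i j;
    rewrite [LHS]mxE [LHS]mxE [RHS]mxE.
  - by rewrite !ord1 lshift0 Y0 eqxx.
  - by rewrite ord1 lshift0 Y0.
  - by rewrite (ord1 j) lshift0 Y0'.
have [A' [B' [d' [oA' oB' d0' dS ZE]]]] := IHn m le_nm (drsubmx Y).
pose A : 'M[R]_m.+1 := P^T *m (block_mx 1%:M 0 0 A' : 'M[R]_(1 + m)).
pose B : 'M[R]_n.+1 := (block_mx 1%:M 0 0 B' : 'M[R]_(1 + n)) *m Q.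
pose d : 'cV[R]_(1 + n) := col_mx s%:M d'.
have oA : orthomx A by apply/orthomx_mulmx/orthomx_block/oA'/orthomx_trmx.
have oB : orthomx B by apply: orthomx_mulmx oQ; exact: orthomx_block.
have XE : X = A *m rdiag_mx m.+1 d *m B.
  have -> : X = P^T *m Y *m Q.
    by rewrite /Y !mulmxA (mulmx1C oP) mul1mx -mulmxA (mulmx1C oQ) mulmx1.
  suff -> : Y =
      block_mx 1%:M 0 0 A' *m rdiag_mx (1 + m) d *m block_mx 1%:M 0 0 B'.
    by rewrite /A /B !mulmxA.
  rewrite YE ZE (rdiag_mx_col_mx m s d') !mulmx_block.
  by rewrite !(mul0mx, mulmx0, mul1mx, addr0, add0r) mulmx1.
have DE : A^T *m X *m B^T = rdiag_mx m.+1 d.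
  by rewrite XE rdiag_mx_of_svd.
(* The diagonal entries are values of u X v^T at rows of A^T and B. *)
have d_le j : d j 0 <= s.
  pose i := widen_ord le_nm j.
  have /= := smax _ _ (dotv_row i (orthomx_trmx oA)) (dotv_row j oB).
  rewrite -row_mul /dotv -[X in X <= _](_ : rdiag_mx m.+1 d i j = _).
    by rewrite mxE eqxx.
  by rewrite -DE !mxE; apply: eq_bigr => k _; rewrite !mxE.
have dE j : d (lift 0 j) 0 = d' j 0.
  by rewrite -(rshift1 j) [LHS]col_mxEd.
have ds : d 0 0 = s by rewrite -(@lshift0 n 0) [LHS]col_mxEu mxE eqxx.
exists A, B, d; split=> // [i|i j].
  by case: (unliftP 0 i) => [k ->|->]; rewrite ?dE// ds.
case: (unliftP 0 i) => [k ->|-> _]; last by rewrite ds.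
by case: (unliftP 0 j) => [l ->|->]//; rewrite !dE; exact: dS.
Qed.

Lemma svd_sigma (R : realType) m n (le_nm : (n <= m)%N) (X : 'M[R]_(m, n)) :
  exists (A : 'M[R]_m) (B : 'M[R]_n),
    [/\ orthomx A, orthomx B, forall i, 0 <= sigma X i 0,
      forall i j : 'I_n, (i <= j)%N -> sigma X j 0 <= sigma X i 0 &
      X = A *m rdiag_mx m (sigma X) *m B].
Proof.
have [A [B [d [oA oB d0 dS XE]]]] := svd le_nm X.
have sE : sigma X = d by rewrite XE sigma_rdiag_mx_sorted.
by exists A, B; rewrite sE.
Qed.

(** * Ky Fan's variational principle *)

Definition sigma_sum (R : rcfType) m n (k : nat) (X : 'M[R]_(m, n)) : R :=
  \sum_(j < n | (j < k)%N) sigma X j 0.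

Definition partial_trace (R : pzSemiRingType) m n (le_nm : (n <= m)%N) (k : nat)
    (A : 'M[R]_m) (B : 'M[R]_n) (X : 'M[R]_(m, n)) : R :=
  \sum_(j < n | (j < k)%N) (A *m X *m B) (widen_ord le_nm j) j.

Lemma partial_trace_linear (R : comPzRingType) m n (le_nm : (n <= m)%N) k
    (A : 'M[R]_m) (B : 'M[R]_n) : scalar (partial_trace le_nm k A B).
Proof.
move=> a X Y; rewrite /partial_trace mulr_sumr -big_split.
apply: eq_bigr => j _.
by rewrite mulmxDr mulmxDl -scalemxAr -scalemxAl !mxE.
Qed.

Lemma ler_norm_sum_ord (R : realDomainType) n (P : pred 'I_n)
    (F : 'I_n -> R) c :
  0 <= c -> (forall i, `|F i| <= c) -> `|\sum_(i < n | P i) F i| <= n%:R * c.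
Proof.
move=> c0 Fc; apply: le_trans (ler_norm_sum _ _ _) _.
rewrite big_mkcond mulr_natl -[n in X in _ <= X]card_ord -sumr_const.
by apply: ler_sum => i _; case: ifP.
Qed.

Lemma partial_trace_bound (R : realFieldType) m n (le_nm : (n <= m)%N) k
    (A : 'M[R]_m) (B : 'M[R]_n) (X : 'M[R]_(m, n)) :
  orthomx A -> orthomx B ->
  `|partial_trace le_nm k A B X| <= n%:R * (n%:R * m%:R) * `|X|.
Proof.
move=> oA oB; rewrite -2!mulrA; apply: ler_norm_sum_ord => [|j].
  by rewrite !mulr_ge0.
rewrite mxE; apply: ler_norm_sum_ord => [|l]; first by rewrite mulr_ge0.
rewrite normrM -[X in _ <= X]mulr1 ler_pM ?normr_ge0 ?orthomx_entry_le1//.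
rewrite mxE; apply: ler_norm_sum_ord => // i.
rewrite normrM -[X in _ <= X]mul1r ler_pM ?normr_ge0 ?orthomx_entry_le1//.
exact: mx_entry_le_norm.
Qed.

Lemma sum_ord_indic (R : pzSemiRingType) n k :
  \sum_(j < n | (j < k)%N) (1 : R) = \sum_(j < n) (j < k)%N%:R.
Proof. by rewrite big_mkcond; apply: eq_bigr => j _; case: (j < k)%N. Qed.

(** Weights in [[0, 1]] of total mass at most [min k n] are best spent on the
largest entries.  With a threshold [c] that separates the first [k] entries of
[d] from the others, the inequality
[d i * a i <= d i * [i < k] + c * (a i - [i < k])] holds termwise. *)
Lemma weighted_sum_le (R : realDomainType) n k (d a : 'I_n -> R) :
  (forall i, 0 <= d i) -> (forall i j : 'I_n, (i <= j)%N -> d j <= d i) ->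
  (forall i, 0 <= a i <= 1) -> \sum_i a i <= \sum_(i < n) (i < k)%N%:R ->
  \sum_i d i * a i <= \sum_(i < n | (i < k)%N) d i.
Proof.
move=> d0 dS a01 sa.
have [c c0 [dc cd]] : exists2 c : R, 0 <= c &
    (forall i : 'I_n, (i < k)%N -> c <= d i) /\
    (forall i : 'I_n, (k <= i)%N -> d i <= c).
  have [kn|nk] := ltnP k n.
    exists (d (Ordinal kn)) => //; split=> i ik; apply: dS => //=.
    exact: ltnW.
  exists 0 => //; split=> i ik; first exact: d0.
  by have := leq_trans nk ik; rewrite leqNgt ltn_ord.
rewrite [X in _ <= X]big_mkcond/=.
apply: (@le_trans _ _
  (\sum_(i < n) (d i * (i < k)%N%:R + c * (a i - (i < k)%N%:R)))).
  apply: ler_sum => i _; have /andP[ai0 ai1] := a01 i.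
  have [ik|ki] := ltnP i k.
    have : 0 <= (d i - c) * (1 - a i) by rewrite mulr_ge0// subr_ge0 ?dc.
    by rewrite mulr1n; lra.
  have : 0 <= (c - d i) * a i by rewrite mulr_ge0// subr_ge0 cd.
  by rewrite mulr0n; lra.
rewrite big_split/= -mulr_sumr sumrB.
rewrite -[X in _ <= X]addr0 lerD//; last by rewrite mulr_ge0_le0// subr_le0.
by apply: ler_sum => i _; case: ifP; rewrite ?mulr1 ?mulr0.
Qed.

Lemma sum_widen_le (R : numDomainType) m n (le_nm : (n <= m)%N)
    (F : 'I_m -> R) :
  (forall i, 0 <= F i) -> \sum_(i < n) F (widen_ord le_nm i) <= \sum_i F i.
Proof.
move=> F0; rewrite -(big_ord_narrow le_nm) big_mkcond; apply: ler_sum => i _.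
by case: ifP.
Qed.

(** Absorbing the singular vectors of [X] into [A] and [B], the partial trace
becomes a sum of terms [A' j i * sigma i * B' i j], each bounded by
[sigma i * (A' j i ^+ 2 + B' i j ^+ 2) / 2].  Rows and columns of orthogonal
matrices are unit vectors, so [sigma i] gets a total weight [a i] as required
by [weighted_sum_le]. *)
Lemma partial_trace_le (R : realType) m n (le_nm : (n <= m)%N) k
    (A : 'M[R]_m) (B : 'M[R]_n) (X : 'M[R]_(m, n)) :
  orthomx A -> orthomx B -> partial_trace le_nm k A B X <= sigma_sum k X.
Proof.
move=> oA oB; have [U [V [oU oV s0 sS XE]]] := svd_sigma le_nm X.
pose w := widen_ord le_nm.
have [A' [B' [oA' oB' E]]] : exists A' B', [/\ orthomx A', orthomx B' &
    A *m X *m B = A' *m rdiag_mx m (sigma X) *m B'].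
  exists (A *m U), (V *m B); split; try exact: orthomx_mulmx.
  by rewrite {1}XE !mulmxA.
pose a i := \sum_(j < n | (j < k)%N) (A' (w j) (w i) ^+ 2 + B' i j ^+ 2) / 2.
have rowA j : \sum_(i < n) A' (w j) (w i) ^+ 2 <= 1.
  rewrite -(orthomx_row_sqr (w j) oA').
  apply: (sum_widen_le _ (F := fun i => A' (w j) i ^+ 2)) => i.
  exact: sqr_ge0.
have colA i : \sum_(j < n) A' (w j) (w i) ^+ 2 <= 1.
  rewrite -(orthomx_col_sqr (w i) oA').
  apply: (sum_widen_le _ (F := fun j => A' j (w i) ^+ 2)) => j.
  exact: sqr_ge0.
have term0 i j : 0 <= (A' (w j) (w i) ^+ 2 + B' i j ^+ 2) / 2.
  by rewrite divr_ge0// addr_ge0// sqr_ge0.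
apply: (@le_trans _ _ (\sum_i sigma X i 0 * a i)); last first.
  apply: weighted_sum_le => // [i|].
    rewrite sumr_ge0//=.
    apply: (@le_trans _ _ (\sum_j (A' (w j) (w i) ^+ 2 + B' i j ^+ 2) / 2)).
      by rewrite /a big_mkcond ler_sum// => j _; case: ifP.
    rewrite -mulr_suml big_split /= (orthomx_row_sqr i oB').
    by have := colA i; lra.
  rewrite /a exchange_big/= -sum_ord_indic ler_sum// => j _.
  rewrite -mulr_suml big_split /= (orthomx_col_sqr j oB').
  by have := rowA j; lra.
rewrite /partial_trace E /a.
under [X in _ <= X]eq_bigr do rewrite mulr_sumr.
rewrite [X in _ <= X]exchange_big/= ler_sum// => j _.
rewrite (mulmx_rdiag_mxE le_nm) ler_sum// => l _; rewrite -/w.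
have := s0 l; have : 0 <= (A' (w j) (w l) - B' l j) ^+ 2 by rewrite sqr_ge0.
by nra.
Qed.

Lemma partial_trace_attained (R : realType) m n (le_nm : (n <= m)%N) k
    (X : 'M[R]_(m, n)) :
  exists A B,
    [/\ orthomx A, orthomx B & partial_trace le_nm k A B X = sigma_sum k X].
Proof.
have [U [V [oU oV s0 sS XE]]] := svd_sigma le_nm X.
exists U^T, V^T; split; try exact: orthomx_trmx.
rewrite /partial_trace {1}XE rdiag_mx_of_svd//.
by apply: eq_bigr => j _; rewrite mxE eqxx.
Qed.

(** * Maxima of linear functions *)

(** A function with a linear support function at every point, all of them
bounded by [C], is a maximum of linear functions; in this form convexity and
the Lipschitz bound can be used without naming the family of linear
functions. *)
Definition has_supports (R : realFieldType) (E : normedModType R) (C : R)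
    (S : E -> R) : Prop :=
  forall x, exists l : E -> R, [/\ scalar l, l x = S x, forall y, l y <= S y
    & forall y, `|l y| <= C * `|y| ].

Lemma has_supports_sigma_sum (R : realType) m n (le_nm : (n <= m)%N) k :
  has_supports (n%:R * (n%:R * m%:R)) (@sigma_sum R m n k).
Proof.
move=> X; have [A [B [oA oB AB]]] := partial_trace_attained le_nm k X.
exists (partial_trace le_nm k A B); split=> //.
- exact: partial_trace_linear.
- by move=> Y; exact: partial_trace_le.
- by move=> Y; exact: partial_trace_bound.
Qed.

Lemma has_supports_lipschitz (R : realFieldType) (E : normedModType R) C
    (S : E -> R) :
  has_supports C S -> forall x y, `|S x - S y| <= C * `|x - y|.
Proof.
move=> suppS.
have half x y : S x - S y <= C * `|x - y|.
  have [l [ll lx lS lC]] := suppS x.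
  apply: le_trans (le_trans (ler_norm _) (lC (x - y))).
  have -> : x - y = -1 *: y + x by rewrite scaleN1r addrC.
  by rewrite ll mulN1r lx addrC lerD2l lerN2.
by move=> x y; rewrite ler_norml half andbT lerNl opprB distrC half.
Qed.

(** The difference quotient of a convex function is nondecreasing in [t]; the
Lipschitz bound keeps it bounded below as [t] tends to [0]. *)
Lemma has_supports_dirderiv (R : realType) (E : normedModType R) C
    (S : E -> R) :
  has_supports C S -> forall x h,
  cvg (t^-1 * (S (x + t *: h) - S x) @[t --> 0^'+]).
Proof.
move=> suppS x h; apply: nondecreasing_at_right_is_cvgr; near=> b.
  move=> s t; rewrite !in_itv/= => /andP[s0 _] /andP[t0 _] st.
  have [l [ll lx lS _]] := suppS (x + s *: h).
  have lE a : l (x + a *: h) = l x + a * l h by rewrite addrC ll addrC.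
  have := lS (x + t *: h); have := lS x; rewrite -lx !lE => h1 h2.
  (* Supporting S at the intermediate point x + s h gives the convexity
     inequality between x, x + s h and x + t h. *)
  have h3 : t * (l x + s * l h - S x) <= s * (S (x + t *: h) - S x) by nra.
  rewrite -(ler_pM2l s0) mulrA divff ?gt_eqF// mul1r -(ler_pM2l t0).
  rewrite [X in _ <= X](_ : _ = s * (S (x + t *: h) - S x))//.
  by field; rewrite gt_eqF.
exists (- (C * `|h|)) => z [t]; rewrite /= in_itv/= => /andP[t0 _] <-.
have := has_supports_lipschitz suppS (x + t *: h) x.
rewrite (addrC x) addrK normrZ gtr0_norm// ler_norml => /andP[+ _].
by rewrite [t^-1 * _]mulrC ler_pdivlMr// mulNr -mulrA (mulrC _ t).
Unshelve. all: by end_near.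
Qed.

(** * Directional derivatives of the singular values *)

Lemma sigma_entryE (R : rcfType) m n (X : 'M[R]_(m, n)) (i : 'I_n) :
  sigma X i 0 = sigma_sum i.+1 X - sigma_sum i X.
Proof.
rewrite /sigma_sum (bigD1 i)//= addrC (eq_bigl (fun j : 'I_n => (j < i)%N)).
  by rewrite addrAC subrr add0r.
by move=> j; rewrite ltnS -val_eqE/= andbC -ltn_neqAle.
Qed.

Lemma sigma_entry_lipschitz (R : realType) m n (le_nm : (n <= m)%N)
    (X Y : 'M[R]_(m, n)) (i : 'I_n) :
  `|sigma X i 0 - sigma Y i 0| <= 2 * (n%:R * (n%:R * m%:R)) * `|X - Y|.
Proof.
have L k := has_supports_lipschitz (has_supports_sigma_sum le_nm k) X Y.
have subACA (a b c d : R) : a - b - (c - d) = a - c - (b - d) by ring.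
have -> : sigma X i 0 - sigma Y i 0 = (sigma_sum i.+1 X - sigma_sum i.+1 Y)
    - (sigma_sum i X - sigma_sum i Y).
  by apply: etrans (subACA _ _ _ _); congr (_ - _); exact: sigma_entryE.
apply: le_trans (ler_normB _ _) (le_trans (lerD (L _) (L _)) _).
by rewrite -mulr2n -[X in X <= _]mulr_natl !mulrA.
Qed.

Lemma scaleB_entry (R : pzRingType) m n a (x y : 'M[R]_(m, n)) i j :
  (a *: (x - y)) i j = a * (x i j - y i j).
Proof. by rewrite !mxE. Qed.

(** The content is that the limit exists: each entry of [sigma] is a difference
of two sums of largest singular values, and these have one-sided directional
derivatives by convexity. *)
Lemma dsigma_cvg (R : realType) m n (le_nm : (n <= m)%N) (X H : 'M[R]_(m, n)) :
  t^-1 *: (sigma (X + t *: H) - sigma X) @[t --> 0^'+] --> dsigma X H.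
Proof.
suff: cvg (t^-1 *: (sigma (X + t *: H) - sigma X) @[t --> 0^'+]) by [].
pose q k (t : R) := t^-1 * (sigma_sum k (X + t *: H) - sigma_sum k X).
have cq k : cvg (q k t @[t --> 0^'+]).
  exact: has_supports_dirderiv (has_supports_sigma_sum le_nm k) X H.
pose L : 'cV[R]_n :=
  \col_i (lim (q i.+1 t @[t --> 0^'+]) - lim (q i t @[t --> 0^'+])).
apply: (cvgP L); apply: cvg_mx => i j; rewrite (ord1 j) mxE.
have distr (a b c d r : R) : r * (a - b - (c - d)) = r * (a - c) - r * (b - d).
  by ring.
have -> : (fun t => (t^-1 *: (sigma (X + t *: H) - sigma X)) i 0) =
    (fun t => q i.+1 t - q i t).
  apply/funext => t.
  rewrite scaleB_entry; apply: etrans (distr _ _ _ _ _).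
  by congr (_ * (_ - _)); exact: sigma_entryE.
exact: cvgB (cq _) (cq _).
Qed.

(** Along a sequence of directions that converges to [H] the difference
quotients have the same limit as along [H] itself, because [sigma] is
Lipschitz. *)
Lemma dsigma_cvg_seq (R : realType) m n (le_nm : (n <= m)%N)
    (X H : 'M[R]_(m, n)) (t : nat -> R) (v : nat -> 'M[R]_(m, n)) :
  (forall k, 0 < t k) -> t @ \oo --> 0 -> v @ \oo --> H ->
  (t k)^-1 *: (sigma (X + t k *: v k) - sigma X) @[k --> \oo] --> dsigma X H.
Proof.
move=> t0 tcvg vcvg; apply: cvg_mx => i j; rewrite (ord1 j).
pose g (s : R) : R := (s^-1 *: (sigma (X + s *: H) - sigma X)) i 0.
have gcvg : g (t k) @[k --> \oo] --> dsigma X H i 0.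
  have /cvg_at_rightP : g s @[s --> 0^'+] --> dsigma X H i 0.
    by apply: cvg_mx_entry; exact: dsigma_cvg.
  exact.
pose y k : R := ((t k)^-1 *: (sigma (X + t k *: v k) - sigma X)) i 0.
pose C : R := 2 * (n%:R * (n%:R * m%:R)).
have gy k : `|g (t k) - y k| <= C * `|H - v k|.
  rewrite [g _]scaleB_entry [y k]scaleB_entry -mulrBr normrM.
  rewrite gtr0_norm ?invr_gt0// mulrC ler_pdivrMr//.
  have subE : X + t k *: H - (X + t k *: v k) = t k *: (H - v k).
    by rewrite opprD addrACA subrr add0r -scalerBr.
  have := sigma_entry_lipschitz le_nm (X + t k *: H) (X + t k *: v k) i.
  rewrite subE normrZ gtr0_norm// mulrCA mulrC -/C.
  by rewrite opprB addrA subrK -mulrA.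
have gy0 : g (t k) - y k @[k --> \oo] --> 0.
  apply/norm_cvg0P.
  apply: (@squeeze_cvgr _ _ _ _ (fun=> 0) (fun k => C * `|H - v k|)).
  - by near=> k; rewrite normr_ge0 gy.
  - exact: cvg_cst.
  - rewrite -[X in _ --> X](mulr0 C); apply: cvgM; first exact: cvg_cst.
    apply/norm_cvg0P; rewrite -[X in _ --> X](subrr H).
    by apply: cvgB => //; exact: cvg_cst.
have yE : y = (fun k => g (t k) - (g (t k) - y k)).
  by apply/funext => k; rewrite opprB addrC subrK.
rewrite -[dsigma X H i 0]subr0.
change (y k @[k --> \oo] --> dsigma X H i 0 - 0).
by rewrite yE; exact: cvgB.
Unshelve. all: by end_near.
Qed.

(** * Tangent cones *)

Lemma rdiag_mx_sandwich_le (R : realFieldType) m n (le_nm : (n <= m)%N)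
    (A : 'M[R]_m) (x : 'cV[R]_n) (B : 'M[R]_n) :
  orthomx A -> orthomx B -> `|A *m rdiag_mx m x *m B| <= n%:R * `|x|.
Proof.
move=> oA oB; apply/mx_norm_leP => [|i j]; first by rewrite mulr_ge0.
rewrite (mulmx_rdiag_mxE le_nm); apply: ler_norm_sum_ord => // l.
rewrite !normrM -[X in _ <= X]mulr1 ler_pM ?orthomx_entry_le1 ?mulr_ge0//.
by rewrite -[X in _ <= X]mul1r ler_pM ?orthomx_entry_le1 ?mx_entry_le_norm.
Qed.

Theorem corollary4p4 (R : realType) (m n : nat) (le_nm : (n <= m)%N)
    (Delta : set 'cV[R]_n) (Delta_sym : absolutely_symmetric Delta)
    (X : 'M[R]_(m, n)) (Gamma_X : associated_mx_set m Delta X) :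
  tangent_cone (associated_mx_set m Delta) X =
  [set H : 'M[R]_(m, n) | tangent_cone Delta (sigma X) (dsigma X H)].
Proof.
apply/seteqP; split=> H /= [t [v [t0 tcvg vcvg tv]]].
  exists t, (fun k => (t k)^-1 *: (sigma (X + t k *: v k) - sigma X)).
  split=> // [|k]; first exact: dsigma_cvg_seq.
  by rewrite scalerA divff ?gt_eqF// scale1r addrC subrK; exact: tv.
pose q k := (t k)^-1 *: (sigma (X + t k *: H) - sigma X).
have qcvg : q @ \oo --> dsigma X H.
  by apply: (dsigma_cvg_seq le_nm (v := fun=> H)) => //; exact: cvg_cst.
have qE k : sigma (X + t k *: H) = sigma X + t k *: q k.
  by rewrite /q scalerA divff ?gt_eqF// scale1r [RHS]addrC subrK.
have /choice[AB ABP] : forall k, exists AB : 'M[R]_m * 'M[R]_n,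
    [/\ orthomx AB.1, orthomx AB.2 &
        X + t k *: H = AB.1 *m rdiag_mx m (sigma (X + t k *: H)) *m AB.2].
  move=> k; have [A [B [oA oB _ _ XE]]] := svd_sigma le_nm (X + t k *: H).
  by exists (A, B).
(* H + E k is the direction from X to the matrix obtained from X + t k *: H by
   replacing its singular values with sigma X + t k *: v k. *)
pose E k := (AB k).1 *m rdiag_mx m (v k - q k) *m (AB k).2.
exists t, (fun k => H + E k); split; [exact: t0|exact: tcvg| |move=> k].
  rewrite -[X in _ --> X]addr0; apply: cvgD; first exact: cvg_cst.
  apply/norm_cvg0P.
  apply: (@squeeze_cvgr _ _ _ _ (fun=> 0) (fun k => n%:R * `|v k - q k|)).
  - near=> k; rewrite normr_ge0/=; have [oA oB _] := ABP k.
    exact: rdiag_mx_sandwich_le.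
  - exact: cvg_cst.
  - rewrite -[X in _ --> X](mulr0 n%:R); apply: cvgM; first exact: cvg_cst.
    apply/norm_cvg0P; rewrite -[X in _ --> X](subrr (dsigma X H)).
    exact: cvgB.
have [oA oB XE] := ABP k.
rewrite /associated_mx_set /=.
have -> : X + t k *: (H + E k) =
    (AB k).1 *m rdiag_mx m (sigma X + t k *: v k) *m (AB k).2.
  have -> : sigma X + t k *: v k = sigma (X + t k *: H) + t k *: (v k - q k).
    by rewrite qE scalerBr addrA addrAC addrK.
  rewrite scalerDr addrA {1}XE rdiag_mxD rdiag_mxZ mulmxDr mulmxDl.
  by rewrite -scalemxAr -scalemxAl.
have [P signP ->] :=
  sigma_rdiag_mx_signed_perm le_nm (sigma X + t k *: v k) oA oB.
by apply: Delta_sym signP _; exact: tv.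
Unshelve. all: by end_near.
Qed.
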